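(* Let $k$ and $n$ be positive integers, and let $a,b$ be positive integers with $b\in\{a-2,a-1\}$ and $a+b<n$. If $\sigma$ is a uniformly random bijection from $\{1,\ldots,n\}$ to $\{k,k+1,\ldots,n+k-1\}$, then $\Pr[D_{a,b}(\sigma)=0]<\frac1n$.
   Context: For a bijection $\sigma:\{1,\ldots,n\}\to\{k,\ldots,n+k-1\}$ (a ''random permutation of $\{k,\ldots,n+k-1\}$'') and positive integers $a,b$ with $a+b<n$, define $D_{a,b}(\sigma)=\sum_{i=1}^{a}\sigma(i)-\sum_{i=a+1}^{a+b}\sigma(i)$. *)

(* Defs.v *)
From HB Require Import structures.
From mathcomp Require Import all_boot all_order all_algebra.

Set Implicit Arguments.
Unset Strict Implicit.
Unset Printing Implicit Defensive.

Import Order.TTheory GRing.Theory Num.Theory.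

Local Open Scope ring_scope.

(* Bijections from {1, ..., n} to {k, ..., n+k-1}.  The domain is 0-based:
   i : 'I_n stands for the element i+1 of {1, ..., n}.  Values are not shifted:
   elements of 'I_(n + k) are at most n+k-1. *)
Definition bijections (n k : nat) : {set {ffun 'I_n -> 'I_(n + k)}} :=
  [set s : {ffun 'I_n -> 'I_(n + k)} |
     injectiveb s && (s @: [set: 'I_n] == [set j : 'I_(n + k) | (k <= j)%N])].

(* With the 0-based domain, sigma(1), ..., sigma(a) are the values at
   0 <= i < a, and sigma(a+1), ..., sigma(a+b) those at a <= i < a + b. *)
Definition Dstat (n k a b : nat) (s : {ffun 'I_n -> 'I_(n + k)}) : int :=
  \sum_(i < n | (i < a)%N) (s i : nat)%:Z
    - \sum_(i < n | (a <= i < a + b)%N) (s i : nat)%:Z.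

Definition unif_pr (T : finType) (Omega : {set T}) (E : pred T) : rat :=
  #|[set x in Omega | E x]|%:R / #|Omega|%:R.

(* Main.v *)
Require Import Defs.
From mathcomp Require Import all_boot all_order all_fingroup all_algebra.
From mathcomp Require Import zify ring.

(* Read a bijection as a word over the values, with weight 1, -1 or 0 at v as v is
   taken in the first a positions, in the next b, or elsewhere, so that D is the
   sum of weight(v) (v + k).  Rotating the word by h changes D by -(a - b) h
   modulo n.  If a - b is invertible modulo n, exactly a proportion 1/n of the
   words has n | D, and some word has n | D but D > 0, whence the strict
   inequality.
   The remaining case is a - b = 2 and n = 2m, where the proportion of words with
   n | D is 1/m times that of the words with D even.  Match the values in pairs of
   opposite parity: v with v + m if m is odd, 2i with 2i + 1 if m is even.
   Exchanging the values of a pair exactly one of which has weight 0 changes the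
   parity of D, so the words having such a pair are evenly split.  The others, the
   matched words, may all have D even, but at least 1/m of these have n | D.
   Let S_j be the sum over v < j of weight(v) - weight(v + m).  Exchanging v and
   v + m for all v < j changes D by m S_j, and doing so for the first j with
   |S_j| = 2 is an involution changing D by n or -n.  Hence at least half of the
   words with n | D for which such a j exists have D <> 0, and the matched words
   with n | D are among them.  Altogether 2m times the number of words with D = 0
   is at most twice the number of words with D even minus the number of matched
   words with D even, which is at most the number of all words.  A word with n | D
   and D >= 2n, which no such exchange sends to D = 0, makes this strict. *)

Set Implicit Arguments.
Unset Strict Implicit.
Unset Printing Implicit Defensive.

Import Order.TTheory GRing.Theory Num.Theory.

Local Open Scope ring_scope.

Section SumInvolution.

Variables (T : finType) (V : nmodType) (p : T -> T) (P : pred T) (F : T -> V).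
Hypotheses (pK : involutive p) (Pp : forall x, P (p x) = ~~ P x).

Lemma sum_involution_cond (D : pred T) : (forall x, D (p x) = D x) ->
  \sum_(x | D x) F x = \sum_(x | D x && P x) (F x + F (p x)).
Proof.
move=> Dp; rewrite (bigID P) big_split; congr (_ + _) => /=.
by rewrite (reindex_inj (inv_inj pK)); apply: eq_bigl => x; rewrite Dp Pp negbK.
Qed.

Lemma sum_involution : \sum_x F x = \sum_(x | P x) (F x + F (p x)).
Proof. exact: (sum_involution_cond (D := xpredT)). Qed.

End SumInvolution.

Lemma rotation_count (T : finType) (rho : T -> T) (A : {set T}) (f : T -> int)
    (c q : nat) :
  (0 < c)%N -> (0 < q)%N -> injective rho ->
  (forall x, (rho x \in A) = (x \in A)) ->
  {in A, forall x, (c * q)%N%:Z %| f (rho x) - f x + c%:Z}%Z ->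
  (q * #|A :&: [set x | (c * q)%N%:Z %| f x]%Z| =
   #|A :&: [set x | c%:Z %| f x]%Z|)%N.
Proof.
move=> c_gt0; case: q => // q _ rho_inj rhoA frho.
pose C (j : nat) := A :&: [set x | (c * q.+1)%N%:Z %| f x - (c * j)%N%:Z]%Z.
have cardC j : #|C j| = #|C 0%N|.
  elim: j => // j <-; rewrite -(card_preimset (C j) rho_inj).
  apply: eq_card => x; rewrite !inE rhoA.
  case: (boolP (x \in A)) => //= /frho frhox.
  rewrite -(rpredDl _ frhox); congr (_ %| _)%Z.
  by rewrite mulnS PoszD; ring.
pose residue x : 'I_q.+1 := inord `|((f x %/ c%:Z)%Z %% q.+1%:Z)%Z|.
rewrite -[RHS]sum1_card (partition_big residue xpredT) //=.
rewrite (eq_bigr (fun=> #|C 0%N|)) => [|j _].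
  rewrite sum_nat_const card_ord; congr (_ * _)%N.
  by apply: eq_card => x; rewrite !inE muln0 subr0.
rewrite sum1dep_card -(cardC j); apply: eq_card => x; rewrite !inE -andbA.
case: (x \in A) => //=; have := ltn_ord j => jq.
have cN0 : c%:Z != 0 by lia.
rewrite -val_eqE /= inordK; last by lia.
apply/andP/idP => [[/dvdzP[z ->]]|/dvdzP[z fE]].
  rewrite mulzK // => /eqP zj; rewrite !PoszM ![c%:Z * _]mulrC -mulrBl.
  by rewrite dvdz_mul2r // -eqz_mod_dvd -zj gez0_abs ?modz_mod ?modz_ge0.
have {}fE : f x = (z * q.+1%:Z + j%:Z) * c%:Z.
  by move/eqP: fE; rewrite subr_eq => /eqP ->; rewrite !PoszM; ring.
by rewrite fE dvdz_mull // mulzK // modzMDl modz_small //; lia.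
Qed.

Lemma toggle_half (T I : finType) (act : I -> T -> T) (Q : T -> pred I)
    (A B : {set T}) :
  (forall i, involutive (act i)) ->
  {in A, forall x i, Q x i ->
    [/\ act i x \in A, Q (act i x) =1 Q x & x \in B -> act i x \notin B]} ->
  {in A :&: B, forall x, exists i, Q x i} ->
  (2 * #|A :&: B| <= #|A|)%N.
Proof.
move=> actK Qact Qex.
pose toggle x := if [pick i | Q x i] is Some i then act i x else x.
have toggleK : {in A, cancel toggle toggle}.
  move=> x xA; rewrite /toggle.
  case pickx: [pick i | Q x i] => [i|]; last by rewrite pickx.
  have Qxi : Q x i by move: pickx; case: pickP => // j Qxj [<-].
  by have [_ /eq_pick -> _] := Qact x xA _ Qxi; rewrite pickx actK.
have toggle_inj : {in A :&: B &, injective toggle}.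
  by apply: can_in_inj => x /setIP[xA _]; apply: toggleK.
have sub : toggle @: (A :&: B) \subset A :\: B.
  apply/subsetP => _ /imsetP[x /[dup] /Qex[j Qxj] /setIP[xA xB] ->].
  rewrite /toggle; case: pickP => [i Qxi|/(_ j)]; last by rewrite Qxj.
  by have [uA _ /(_ xB) uB] := Qact x xA i Qxi; rewrite inE uA uB.
have := subset_leq_card sub; rewrite card_in_imset // -(cardsID B A); lia.
Qed.

Section PairSwap.

Variables (T : finType) (p : {perm T}) (e : rel T).
Hypotheses (pK : involutive p) (e_sym : symmetric e).

Lemma rel_pair_swap x (t : {perm T}) y :
  e ((tperm x (p x) * t)%g y) ((tperm x (p x) * t)%g (p y)) = e (t y) (t (p y)).
Proof.
have -> : (tperm x (p x) * t)%g (p y) = t (p (tperm x (p x) y)).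
  rewrite permM; congr (t _); case: (tpermP x _ y) => [->|->|/eqP xy /eqP xpy].
  - by rewrite tpermR pK.
  - by rewrite pK tpermL.
  - rewrite tpermD 1?eq_sym ?(inj_eq perm_inj) //.
    by apply: contraNneq xpy => <-; rewrite pK.
by rewrite permM; case: tpermP => [->|->|] //; rewrite ?pK e_sym.
Qed.

Lemma pair_swap_half (A B : {set {perm T}}) :
  {in A, forall (t : {perm T}) x, e (t x) (t (p x)) ->
    (tperm x (p x) * t)%g \in A /\
    (t \in B -> (tperm x (p x) * t)%g \notin B)} ->
  {in A :&: B, forall t : {perm T}, exists x, e (t x) (t (p x))} ->
  (2 * #|A :&: B| <= #|A|)%N.
Proof.
move=> eA ex; pose Q (t : {perm T}) x := e (t x) (t (p x)).
apply: (@toggle_half _ _ (fun x t => tperm x (p x) * t)%g Q) => //.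
  by move=> x t; rewrite mulgA tperm2 mul1g.
move=> t tA x etx; have [uA uB] := eA t tA x etx; split=> // y.
exact: rel_pair_swap.
Qed.

End PairSwap.

Section WeightedSum.

Variables n' k : nat.
Local Notation n := n'.+1.
Variable wt : 'I_n -> int.
Implicit Types (s t p : 'S_n) (v x y h : 'I_n).

Definition wsum t : int := \sum_v wt (t v) * (v + k)%N%:Z.

Definition wsum_dvd (d : nat) : {set 'S_n} := [set t | d%:Z %| wsum t]%Z.

Lemma mem_wsum_dvd d t : (t \in wsum_dvd d) = (d%:Z %| wsum t)%Z.
Proof. by rewrite inE. Qed.

Definition wsum_zero : {set 'S_n} := [set t | wsum t == 0].

Lemma sum_wt t : \sum_v wt (t v) = \sum_i wt i.
Proof. by rewrite [RHS](reindex_inj (@perm_inj _ t)). Qed.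

Lemma wsum_inverse t : wsum t = \sum_i wt i * ((t^-1)%g i + k)%N%:Z.
Proof.
rewrite [RHS](reindex_inj (@perm_inj _ t)).
by apply: eq_bigr => v _; rewrite permK.
Qed.

Lemma wsum_mul s t :
  wsum (s * t)%g = wsum t + \sum_v wt (t (s v)) * (v%:Z - (s v)%:Z).
Proof.
rewrite [X in X + _](reindex_inj (@perm_inj _ s)) -big_split /=.
by apply: eq_bigr => v _; rewrite permM !PoszD; ring.
Qed.

Lemma wsum_tperm x y t :
  wsum (tperm x y * t)%g = wsum t + (wt (t x) - wt (t y)) * (y%:Z - x%:Z).
Proof.
have [->|xy] := eqVneq x y; first by rewrite tperm1 mul1g; ring.
rewrite wsum_mul (bigD1 x) // (bigD1 y) 1?eq_sym //= tpermL tpermR big1.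
  by ring.
by move=> v /andP[vx vy]; rewrite tpermD 1?eq_sym // subrr mulr0.
Qed.

Lemma wsum_zero_sub_dvd d : wsum_zero \subset wsum_dvd d.
Proof. by apply/subsetP => t; rewrite !inE => /eqP ->; rewrite dvdz0. Qed.

Definition rotation h : 'S_n := perm (@addrI _ h).

Lemma rotationE h v :
  rotation h v = (if h + v < n then h + v else h + v - n)%N :> nat.
Proof.
rewrite permE /=; have [hn vn] := (ltn_ord h, ltn_ord v).
case: ltnP => hv; first by rewrite modn_small.
by rewrite -[in LHS](subnK hv) modnDr modn_small; lia.
Qed.

Lemma wsum_rotation h t :
  (n%:Z %| wsum (rotation h * t)%g - wsum t + (\sum_i wt i) * h%:Z)%Z.
Proof.
rewrite wsum_mul [wsum t + _]addrC addrK -(sum_wt (rotation h * t)) big_distrl.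
rewrite -big_split rpred_sum //= => v _; rewrite permM -mulrDr dvdz_mull //.
rewrite rotationE; case: ltnP => hv.
  by rewrite (_ : _ + h%:Z = 0) ?dvdz0 //; lia.
by rewrite (_ : _ + h%:Z = n%:Z) ?dvdzz //; lia.
Qed.

Lemma wsum_dvd_rotation_count (c q : nat) h (A : {set 'S_n}) :
  n = (c * q)%N -> (n%:Z %| (\sum_i wt i) * h%:Z - c%:Z)%Z ->
  (forall t, (rotation h * t \in A)%g = (t \in A)) ->
  (q * #|A :&: wsum_dvd n|)%N = #|A :&: wsum_dvd c|.
Proof.
move=> nE hc Ah; have := @rotation_count _ (mulg (rotation h)) A wsum c q.
rewrite -nE; apply=> //; try lia; first exact: mulgI.
move=> t _; rewrite -(rpredDr _ hc) -addrA [c%:Z + _]addrC subrK.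
exact: wsum_rotation.
Qed.

Lemma wsum_zero_lt_coprime h t :
  (n%:Z %| (\sum_i wt i) * h%:Z - 1)%Z -> (n%:Z %| wsum t)%Z -> wsum t != 0 ->
  (n * #|wsum_zero| < #|{: 'S_n}|)%N.
Proof.
move=> hc tn tN0.
have /(_ setT) := wsum_dvd_rotation_count (esym (mul1n n)) hc.
rewrite !setTI => cardE.
apply: (@leq_trans (n * #|wsum_dvd n|)%N); last first.
  by rewrite cardE ?max_card // => u; rewrite !inE.
rewrite ltn_mul2l /= proper_card // properE wsum_zero_sub_dvd.
by apply/subsetPn; exists t; rewrite inE.
Qed.

Definition same_support (i j : 'I_n) : bool := (wt i == 0) == (wt j == 0).

Definition matched p : {set 'S_n} :=
  [set t : 'S_n | [forall v, same_support (t v) (t (p v))]].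

Lemma matched_mul p s t : (forall v, s (p v) = p (s v)) ->
  ((s * t)%g \in matched p) = (t \in matched p).
Proof.
move=> sp; rewrite !inE; apply/forallP/forallP => matched_t v.
  by have := matched_t (s^-1%g v); rewrite !permM sp permKV.
by rewrite !permM sp.
Qed.

Hypothesis wt_sign : forall i, [\/ wt i = 0, wt i = 1 | wt i = - 1].

Lemma matched_pair_even p t v : t \in matched p ->
  (2 %| wt (t v) + wt (t (p v)))%Z.
Proof.
rewrite inE => /forallP/(_ v); rewrite /same_support.
by case: (wt_sign (t v)) => ->; case: (wt_sign (t (p v))) => ->.
Qed.

Section ParityReversingMatching.

Variable p : 'S_n.
Hypotheses (pK : involutive p) (odd_p : forall v, odd (p v) = ~~ odd v).

Let same_support_sym : symmetric same_support.
Proof. by move=> i j; apply: eq_sym. Qed.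

Lemma matched_pair_swap v t :
  ((tperm v (p v) * t)%g \in matched p) = (t \in matched p).
Proof. by rewrite !inE; apply: eq_forallb => x; rewrite rel_pair_swap. Qed.

Lemma unmatched_even_half :
  (2 * #|~: matched p :&: wsum_dvd 2| <= #|~: matched p|)%N.
Proof.
pose e := [rel i j | ~~ same_support i j].
apply: (@pair_swap_half _ p e) => // [i j|t tp v|t].
- by rewrite /= same_support_sym.
- rewrite !in_setC matched_pair_swap => vp; split; first by rewrite -in_setC.
  move: vp; rewrite !mem_wsum_dvd wsum_tperm /= /same_support; have := odd_p v.
  by case: (wt_sign (t v)) => ->; case: (wt_sign (t (p v))) => -> //=; lia.
- by rewrite !inE negb_forall => /andP[/existsP].
Qed.

Hypothesis wt_sum : \sum_i wt i = 2.

Lemma exists_unequal_pair t :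
  (2 %| wsum t)%Z -> exists v, wt (t v) != wt (t (p v)).
Proof.
move=> even_t; apply/existsP; rewrite -negb_forall; apply: contraL even_t.
move/forallP => wt_p.
have evenP v : ~~ odd (p v) = ~~ ~~ odd v by rewrite odd_p.
have sum_even : \sum_(v : 'I_n | ~~ odd v) wt (t v) = 1.
  apply: (@mulfI _ 2) => //; rewrite mulr1 big_distrr -[RHS]wt_sum -(sum_wt t).
  rewrite (sum_involution _ pK evenP); apply: eq_bigr => v _ /=.
  by rewrite -(eqP (wt_p v)); ring.
suff /(rpredDl 1) : (2 %| wsum t - 1)%Z by rewrite subrK => ->.
rewrite -[X in _ - X]sum_even /wsum (sum_involution _ pK evenP) -sumrB.
apply: rpred_sum => v _.
rewrite -(eqP (wt_p v)) -mulrDr -{2}[wt (t v)]mulr1 -mulrBr dvdz_mull //.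
by have := odd_p v; lia.
Qed.

End ParityReversingMatching.

Section EvenSize.

Variable m : nat.
Hypothesis nE : n = (2 * m)%N.

Definition antipode : 'S_n := rotation (inord m).

Lemma antipodeE v : antipode v = (if v < m then v + m else v - m)%N :> nat.
Proof.
have := ltn_ord v; rewrite rotationE inordK; last by lia.
by case: ifP; case: ifP; lia.
Qed.

Lemma antipodeK : involutive antipode.
Proof.
move=> v; apply: val_inj; have := ltn_ord v; rewrite /= !antipodeE.
by case: (ltnP v m); case: ifP; lia.
Qed.

Lemma ltn_antipode v : (antipode v < m)%N = ~~ (v < m)%N.
Proof. by have := ltn_ord v; rewrite antipodeE; case: ifP; lia. Qed.

Lemma mod_antipode v : (antipode v %% m = v %% m)%N.
Proof.
rewrite antipodeE; case: ltnP => vm; first exact: modnDr.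
by rewrite -[in RHS](subnK vm) modnDr.
Qed.

Lemma odd_antipode v : odd m -> odd (antipode v) = ~~ odd v.
Proof. by have := ltn_ord v; rewrite antipodeE; case: ifP; lia. Qed.

Definition balance t (j : nat) : int :=
  \sum_(v : 'I_n | (v < j)%N) (wt (t v) - wt (t (antipode v))).

Lemma balance0 t : balance t 0 = 0.
Proof. by rewrite /balance big_pred0. Qed.

Lemma balanceS t v :
  balance t v.+1 = balance t v + (wt (t v) - wt (t (antipode v))).
Proof.
rewrite /balance (bigD1 v) //= addrC; congr (_ + _); apply: eq_bigl => x.
by rewrite -val_eqE /=; lia.
Qed.

Definition swap_antipodes_below (j : nat) v : 'I_n :=
  if (v %% m < j)%N then antipode v else v.

Lemma swap_antipodes_belowK j : involutive (swap_antipodes_below j).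
Proof.
move=> v; rewrite /swap_antipodes_below.
by case vj: (v %% m < j)%N; rewrite ?mod_antipode vj // antipodeK.
Qed.

Definition antipode_below (j : nat) : 'S_n :=
  perm (inv_inj (swap_antipodes_belowK j)).

Lemma antipode_belowE j v : (v < m)%N ->
  antipode_below j v = (if v < j then antipode v else v)%N /\
  antipode_below j (antipode v) = (if v < j then v else antipode v)%N.
Proof.
move=> vm; have swapE : antipode_below j =1 swap_antipodes_below j := permE _.
rewrite !swapE /swap_antipodes_below mod_antipode (modn_small vm) antipodeK.
by case: ifP.
Qed.

Lemma wsum_antipode_below j t : (j <= m)%N ->
  wsum (antipode_below j * t)%g = wsum t + m%:Z * balance t j.
Proof.
move=> jm; rewrite wsum_mul; congr (_ + _).
rewrite (sum_involution _ antipodeK ltn_antipode).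
rewrite /balance big_distrr [LHS]big_mkcond [RHS]big_mkcond.
apply: eq_bigr => v _ /=.
case: ltnP => vm; last by rewrite ifF //; lia.
have [-> ->] := antipode_belowE j vm; case: ifP => vj; last by ring.
by rewrite antipodeE vm PoszD; ring.
Qed.

Lemma balance_antipode_below i j t : (i <= j <= m)%N ->
  balance (antipode_below j * t)%g i = - balance t i.
Proof.
move=> /andP[ij jm]; rewrite /balance -sumrN; apply: eq_bigr => v vi.
have [|belowE below_antipodeE] := @antipode_belowE j v; first by lia.
by rewrite !permM belowE below_antipodeE (leq_trans vi ij) opprB.
Qed.

Definition unbalanced_at t (j : nat) : bool := `|balance t j| == 2.

Definition unbalanced : {set 'S_n} :=
  [set t | [exists j : 'I_m.+1, unbalanced_at t j]].

Definition first_unbalanced_at t (j : 'I_m.+1) : bool :=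
  unbalanced_at t j && [forall i : 'I_m.+1, (i < j)%N ==> ~~ unbalanced_at t i].

Lemma exists_first_unbalanced_at t :
  t \in unbalanced -> exists j, first_unbalanced_at t j.
Proof.
rewrite inE => /existsP[j0 tj0].
have [j tj minj] :=
  @arg_minnP _ j0 (fun j : 'I_m.+1 => unbalanced_at t j) val tj0.
exists j; rewrite /first_unbalanced_at tj; apply/forallP => i; apply/implyP.
by rewrite ltnNge; apply: contra => /minj.
Qed.

Lemma first_unbalanced_at_antipode_below t i : first_unbalanced_at t i ->
  first_unbalanced_at (antipode_below i * t)%g =1 first_unbalanced_at t.
Proof.
have unbalancedE j : (j <= i)%N ->
    unbalanced_at (antipode_below i * t)%g j = unbalanced_at t j.
  move=> ji; rewrite /unbalanced_at balance_antipode_below ?normrN //.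
  by rewrite ji -ltnS ltn_ord.
move=> /andP[ti _] j; have [ji|ij] := leqP j i.
  rewrite /first_unbalanced_at unbalancedE //; congr (_ && _).
  apply: eq_forallb => l; case: ltnP => //= lj; rewrite unbalancedE //; lia.
by apply/idP/idP => /andP[_ /forallP/(_ i)/implyP/(_ ij)];
  rewrite ?unbalancedE ?ti.
Qed.

Lemma wsum_first_unbalanced_at t j : first_unbalanced_at t j ->
  wsum (antipode_below j * t)%g = wsum t + n%:Z \/
  wsum (antipode_below j * t)%g = wsum t - n%:Z.
Proof.
move=> /andP[/eqP tj _]; rewrite wsum_antipode_below -1?ltnS ?ltn_ord // nE.
by have [->|->] : balance t j = 2 \/ balance t j = -2; lia.
Qed.

(* Reflection principle: exchanging [v] with its antipode for all [v] below the
   first imbalance of size 2 changes the sign of all balances up to there. *)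
Lemma unbalanced_reflection_half (d : int) : 2 * n%:Z <= d ->
  (2 * #|(wsum_dvd n :&: unbalanced)
           :&: [set t | (wsum t == 0) || (wsum t == d)]|
     <= #|wsum_dvd n :&: unbalanced|)%N.
Proof.
move=> d_large.
apply: (@toggle_half _ _ (fun (j : 'I_m.+1) t => antipode_below j * t)%g
          first_unbalanced_at) => [j t|t|t].
- by apply/permP => v; rewrite !permM !permE swap_antipodes_belowK.
- move=> /setIP[tn _] j tj; have firstE := first_unbalanced_at_antipode_below tj.
  have change := wsum_first_unbalanced_at tj; split=> //.
    rewrite inE mem_wsum_dvd; apply/andP; split.
      move: tn; rewrite mem_wsum_dvd.
      by case: change => -> tn; rewrite ?rpredB ?rpredD.
    by rewrite inE; apply/existsP; exists j; have /andP[] := etrans (firstE j) tj.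
  by rewrite !inE => /orP[/eqP E|/eqP E]; case: change => ->; rewrite E; lia.
- by move=> /setIP[/setIP[_ /exists_first_unbalanced_at]].
Qed.

Lemma wsum_zero_reflection_bound t0 :
  (n%:Z %| wsum t0)%Z -> 2 * n%:Z <= wsum t0 ->
  (2 * #|wsum_zero|.+1 + #|wsum_dvd n :&: unbalanced| <= 2 * #|wsum_dvd n|)%N.
Proof.
move=> t0n t0_large; have := unbalanced_reflection_half t0_large.
set B := [set t | _] => half.
have zero_lt : (#|wsum_zero| < #|wsum_dvd n :&: B|)%N.
  apply/proper_card/properP; split.
    rewrite subsetI wsum_zero_sub_dvd; apply/subsetP => t.
    by rewrite !inE => ->.
  by exists t0; [rewrite inE mem_wsum_dvd t0n !inE eqxx orbT | rewrite inE; lia].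
have := cardsID unbalanced (wsum_dvd n).
have := cardsID unbalanced (wsum_dvd n :&: B); rewrite setIAC -setIDAC.
have := subset_leq_card (subsetIl (wsum_dvd n :\: unbalanced) B); lia.
Qed.

Hypothesis wt_sum : \sum_i wt i = 2.

Lemma wsum_dvd_rotation_count_even (h q : nat) (A : {set 'S_n}) :
  n = (2 * h * q)%N -> (forall t, (rotation (inord h) * t \in A)%g = (t \in A)) ->
  (q * #|A :&: wsum_dvd n|)%N = #|A :&: wsum_dvd (2 * h)|.
Proof.
move=> hqE; have hn : (h < n)%N by case: q hqE => [|q]; nia.
apply: wsum_dvd_rotation_count => //.
by rewrite wt_sum inordK // PoszM subrr dvdz0.
Qed.

Lemma wsum_zero_lt_matching p t0 :
  involutive p -> (forall v, odd (p v) = ~~ odd v) ->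
  (#|matched p :&: wsum_dvd 2| <= m * #|matched p :&: wsum_dvd n|)%N ->
  matched p :&: wsum_dvd n \subset unbalanced ->
  (n%:Z %| wsum t0)%Z -> 2 * n%:Z <= wsum t0 ->
  (n * #|wsum_zero| < #|{: 'S_n}|)%N.
Proof.
move=> pK odd_p matched_even matched_unbalanced t0n t0_large.
have dvd_count : (m * #|wsum_dvd n|)%N = #|wsum_dvd 2|.
  have := @wsum_dvd_rotation_count_even 1 m setT; rewrite !setTI; apply=> // t.
  by rewrite !inE.
have /(leq_mul (leqnn m)) := wsum_zero_reflection_bound t0n t0_large.
have := unmatched_even_half pK odd_p; rewrite [~: _ :&: _]setIC -setDE.
have := subset_leq_card (subsetIl (matched p) (wsum_dvd 2)).
have /(leq_mul (leqnn m)) :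
    (#|matched p :&: wsum_dvd n| <= #|wsum_dvd n :&: unbalanced|)%N.
  by rewrite subset_leq_card // subsetI subsetIr.
have := cardsID (matched p) (wsum_dvd 2); rewrite setIC.
have : (#|matched p| + #|~: matched p|)%N = #|{: 'S_n}| := cardsC _.
by rewrite [X in (X * _ < _)%N]nE; lia.
Qed.

Lemma matched_antipode_unbalanced : odd m ->
  matched antipode :&: wsum_dvd n \subset unbalanced.
Proof.
move=> m_odd; apply/subsetP => t; rewrite inE mem_wsum_dvd inE.
move=> /andP[/forallP matched_t n_t].
apply: contraT; rewrite inE negb_exists => /forallP balanced.
have even_t : (2 %| wsum t)%Z.
  by apply: dvdz_trans n_t; rewrite nE PoszM dvdz_mulr.
have balance_eq0 j : (j <= m)%N -> balance t j = 0.
  elim: j => [|j IHj] jm; first exact: balance0.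
  have jn : (j < n)%N by lia.
  pose v : 'I_n := Ordinal jn.
  have := balanceS t v; rewrite IHj 1?ltnW //= => balanceE.
  have := balanced (Ordinal (jm : (j.+1 < m.+1)%N)).
  rewrite /unbalanced_at /= balanceE.
  have := matched_t v; rewrite /same_support.
  by case: (wt_sign (t v)) => ->; case: (wt_sign (t (antipode v))) => ->.
have eq_lower v : (v < m)%N -> wt (t v) = wt (t (antipode v)).
  by move=> vm; have := balanceS t v; rewrite !balance_eq0 //; lia.
have [v /eqP[]] :=
  exists_unequal_pair antipodeK (odd_antipode^~ m_odd) wt_sum even_t.
have [/eq_lower //|mv] := ltnP v m.
by rewrite (eq_lower (antipode v)) ?antipodeK // ltn_antipode -leqNgt.
Qed.

Definition toggle_parity v : 'I_n := inord (if odd v then v.-1 else v.+1).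

Lemma toggle_parityE v :
  toggle_parity v = (if odd v then v.-1 else v.+1) :> nat.
Proof. by rewrite inordK //; have := ltn_ord v; case: ifP; lia. Qed.

Lemma toggle_parityK : involutive toggle_parity.
Proof.
move=> v; apply: val_inj; rewrite /= !toggle_parityE.
by case: (boolP (odd v)); case: ifP; lia.
Qed.

Definition neighbour : 'S_n := perm (inv_inj toggle_parityK).

Lemma neighbourE v : neighbour v = (if odd v then v.-1 else v.+1) :> nat.
Proof. by rewrite permE toggle_parityE. Qed.

Lemma neighbourK : involutive neighbour.
Proof. by move=> v; rewrite !permE toggle_parityK. Qed.

Lemma odd_neighbour v : odd (neighbour v) = ~~ odd v.
Proof. by rewrite neighbourE; case: ifP; lia. Qed.

Lemma neighbour_rotation h v :
  ~~ odd h -> neighbour (rotation h v) = rotation h (neighbour v).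
Proof.
move=> h_even; apply: val_inj; have := ltn_ord v; have := ltn_ord h.
rewrite /= neighbourE !rotationE neighbourE.
by case: (boolP (odd v)); repeat case: ifP; lia.
Qed.

Lemma neighbour_antipode v :
  ~~ odd m -> neighbour (antipode v) = antipode (neighbour v).
Proof. by move=> m_even; rewrite neighbour_rotation // inordK; lia. Qed.

Lemma balance_half t :
  balance t m + 2 = 2 * \sum_(v : 'I_n | (v < m)%N) wt (t v).
Proof.
rewrite -[X in _ + X]wt_sum -(sum_wt t) /balance.
rewrite (sum_involution _ antipodeK ltn_antipode).
by rewrite -big_split big_distrr; apply: eq_bigr => v _ /=; ring.
Qed.

Lemma matched_neighbour_unbalanced :
  ~~ odd m -> matched neighbour \subset unbalanced.
Proof.
move=> m_even; apply/subsetP => t matched_t; rewrite inE.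
apply: contraT; rewrite negb_exists => /forallP balanced.
have balance_neq2 j : (j <= m)%N -> `|balance t j| != 2.
  by move=> jm; apply: (balanced (Ordinal (jm : (j < m.+1)%N))).
have balance_eq0 i : (2 * i <= m)%N -> balance t (2 * i) = 0.
  elim: i => [|i IHi] im; first exact: balance0.
  have vn : (2 * i < n)%N by lia.
  pose v := Ordinal vn; pose u := neighbour v.
  have uE : u = (2 * i).+1 :> nat by rewrite neighbourE /=; case: ifP; lia.
  have := balanceS t u; have := balanceS t v.
  rewrite uE [val v]/= IHi; last by lia.
  have := balance_neq2 (2 * i).+1; have := balance_neq2 (2 * i).+2.
  have := matched_pair_even v matched_t.
  have := matched_pair_even (antipode v) matched_t.
  rewrite mulnS add2n neighbour_antipode // -/u.
  case: (wt_sign (t v)) => ->; case: (wt_sign (t u)) => ->;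
    case: (wt_sign (t (antipode v))) => ->;
    case: (wt_sign (t (antipode u))) => ->; lia.
have lower_even : (2 %| \sum_(v : 'I_n | (v < m)%N) wt (t v))%Z.
  have even_split v : ~~ odd (neighbour v) = ~~ ~~ odd v by rewrite odd_neighbour.
  rewrite (sum_involution_cond _ neighbourK even_split) => [|v].
    by apply: rpred_sum => v _; apply: matched_pair_even.
  by rewrite neighbourE; case: ifP; lia.
have mE : m = (2 * m./2)%N by lia.
have := balance_half t; rewrite {1}mE balance_eq0 -?mE //.
by move/dvdzP: lower_even => [z ->]; lia.
Qed.

Lemma matched_antipode_even_count :
  (m * #|matched antipode :&: wsum_dvd n|)%N = #|matched antipode :&: wsum_dvd 2|.
Proof.
apply: (@wsum_dvd_rotation_count_even 1 m) => // t.
by apply: matched_mul => v; rewrite !permE addrCA.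
Qed.

Lemma matched_neighbour_dvd4_half :
  (#|matched neighbour :&: wsum_dvd 2| <=
     2 * #|matched neighbour :&: wsum_dvd 4|)%N.
Proof.
set A := matched neighbour :&: wsum_dvd 2.
have half : (2 * #|A :&: ~: wsum_dvd 4| <= #|A|)%N.
  pose e i j := wt i != wt j.
  apply: (@pair_swap_half _ neighbour e neighbourK) => [i j|t|t].
  - by rewrite /e eq_sym.
  - rewrite in_setI mem_wsum_dvd => /andP[matched_t even_t] v.
    rewrite in_setI !in_setC !mem_wsum_dvd matched_pair_swap ?matched_t;
      last exact: neighbourK.
    rewrite wsum_tperm /e; move: matched_t even_t.
    rewrite inE => /forallP/(_ v); rewrite /same_support neighbourE.
    case: (wt_sign (t v)) => ->; case: (wt_sign (t (neighbour v))) => -> //= _;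
      by case: ifP; lia.
  - move=> /setIP[/setIP[_ even_t] _]; apply: exists_unequal_pair => //.
    + exact: neighbourK.
    + exact: odd_neighbour.
    + by rewrite -mem_wsum_dvd.
have dvd4_sub : A :&: wsum_dvd 4 = matched neighbour :&: wsum_dvd 4.
  by apply/setP => t; rewrite !in_setI !mem_wsum_dvd; case: (t \in _) => //=; lia.
have := cardsID (wsum_dvd 4) A; rewrite dvd4_sub setDE; lia.
Qed.

Lemma matched_neighbour_even_count : ~~ odd m ->
  (#|matched neighbour :&: wsum_dvd 2| <=
     m * #|matched neighbour :&: wsum_dvd n|)%N.
Proof.
move=> m_even; have := matched_neighbour_dvd4_half.
rewrite -(@wsum_dvd_rotation_count_even 2 m./2) => [||t]; [by nia | by lia |].
by apply: matched_mul => v; rewrite neighbour_rotation // inordK; lia.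
Qed.

Lemma wsum_zero_lt_even t0 : (n%:Z %| wsum t0)%Z -> 2 * n%:Z <= wsum t0 ->
  (n * #|wsum_zero| < #|{: 'S_n}|)%N.
Proof.
have [m_odd|m_even] := boolP (odd m).
  apply: (wsum_zero_lt_matching antipodeK).
  - by move=> v; rewrite odd_antipode.
  - by rewrite matched_antipode_even_count.
  - exact: matched_antipode_unbalanced.
apply: (wsum_zero_lt_matching neighbourK).
- exact: odd_neighbour.
- exact: matched_neighbour_even_count.
- exact: subset_trans (subsetIl _ _) (matched_neighbour_unbalanced m_even).
Qed.

End EvenSize.

End WeightedSum.

Definition ab_weight n (a b : nat) (i : 'I_n) : int :=
  ((i < a)%N : nat)%:Z - ((a <= i < a + b)%N : nat)%:Z.

Lemma ab_weight_sign n a b (i : 'I_n) :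
  [\/ ab_weight a b i = 0, ab_weight a b i = 1 | ab_weight a b i = - 1].
Proof.
rewrite /ab_weight; case: ltnP => ai /=; first by constructor 2; lia.
by case: ltnP => ab /=; [constructor 3|constructor 1].
Qed.

Lemma ab_weight_eq0 n a b (i : 'I_n) : (a + b <= i)%N -> ab_weight a b i = 0.
Proof. by rewrite /ab_weight; lia. Qed.

Lemma sum_ab_weight n a b (F : 'I_n -> int) :
  \sum_(i < n) ab_weight a b i * F i =
  \sum_(i < n | (i < a)%N) F i - \sum_(i < n | (a <= i < a + b)%N) F i.
Proof.
rewrite [X in X - _]big_mkcond [X in _ - X]big_mkcond -sumrB.
apply: eq_bigr => i _; rewrite /ab_weight mulrBl.
by case: (i < a)%N; case: (a <= i < a + b)%N; rewrite ?mul1r ?mul0r.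
Qed.

Lemma sum_ab_weight_nat n a b (F : nat -> int) : (a + b <= n)%N ->
  \sum_(i < n) ab_weight a b i * F i =
  \sum_(0 <= i < a) F i - \sum_(a <= i < a + b) F i.
Proof.
move=> abn; have an : (a <= n)%N by lia.
rewrite sum_ab_weight (big_nat_widen _ _ _ _ _ an) (big_nat_widen _ _ _ _ _ abn).
rewrite [X in _ = _ - X](big_nat_widenl _ 0) // !big_mkord; congr (_ - _).
by apply: eq_bigl => i; rewrite andbC.
Qed.

Lemma sum_ab_weight1 n a b : (a + b <= n)%N ->
  \sum_(i < n) ab_weight a b i = a%:Z - b%:Z.
Proof.
move=> abn; rewrite (eq_bigr (fun i => ab_weight a b i * 1)) => [|i _].
  by rewrite (sum_ab_weight_nat (fun=> 1)) // !sumr_const_nat; lia.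
by rewrite mulr1.
Qed.

Lemma exists_perm_prefix n (l : seq nat) : uniq l -> all (ltn^~ n) l ->
  exists s : 'S_n, forall i : 'I_n, (i < size l)%N -> s i = nth 0%N l i :> nat.
Proof.
move=> uniq_l l_lt; pose L := l ++ [seq x <- iota 0 n | x \notin l].
have permL : perm_eq L (iota 0 n).
  rewrite uniq_perm ?cat_uniq ?uniq_l ?filter_uniq ?iota_uniq ?andbT //=.
    by apply/hasPn => x; rewrite mem_filter => /andP[].
  move=> x; rewrite mem_cat mem_filter mem_iota.
  case: (boolP (x \in l)) => //= xl.
  by have /= -> := allP l_lt x xl.
have sizeL : size L = n by rewrite (perm_size permL) size_iota.
have L_lt i : (i < n)%N -> (nth 0 L i < n)%N.
  by rewrite -{1}sizeL => /(mem_nth 0%N); rewrite (perm_mem permL) mem_iota.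
have nth_inj : injective (fun i : 'I_n => Ordinal (L_lt i (ltn_ord i))).
  move=> i j /(congr1 val)/eqP /=.
  rewrite nth_uniq ?sizeL //; first by move/eqP/val_inj.
  by rewrite (perm_uniq permL) iota_uniq.
by exists (perm nth_inj) => i il; rewrite permE /= nth_cat il.
Qed.

Lemma exists_perm_wsum n' k (la lb : seq nat) :
  uniq (la ++ lb) -> all (ltn^~ n'.+1) (la ++ lb) ->
  exists t : 'S_n'.+1, wsum k (ab_weight (size la) (size lb)) t =
    \sum_(x <- la) (x + k)%N%:Z - \sum_(x <- lb) (x + k)%N%:Z.
Proof.
move=> uniq_l l_lt; have [s sE] := exists_perm_prefix uniq_l l_lt.
have size_l : (size la + size lb <= n'.+1)%N.
  rewrite -size_cat -(size_iota 0 n'.+1) uniq_leq_size // => x /(allP l_lt).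
  by rewrite mem_iota.
exists s^-1%g; rewrite wsum_inverse invgK.
rewrite (eq_bigr (fun i : 'I_n'.+1 =>
  ab_weight (size la) (size lb) i * (nth 0 (la ++ lb) i + k)%N%:Z)) => [|i _].
  rewrite (sum_ab_weight_nat (fun i => (nth 0 (la ++ lb) i + k)%N%:Z) size_l).
  rewrite [X in _ = X - _](big_nth 0%N) [X in _ = _ - X](big_nth 0%N).
  rewrite -{2}[size la]add0n big_addn addKn; congr (_ - _).
    by apply: eq_big_nat => i /andP[_ ila]; rewrite nth_cat ila.
  by apply: eq_bigr => i _; rewrite nth_cat ltnNge leq_addl /= addnK.
have [/sE -> //|il] := ltnP i (size (la ++ lb)).
by rewrite ab_weight_eq0 ?mul0r // -size_cat.
Qed.

Lemma exists_seq_avoiding (q b : nat) (s : seq nat) : (size s + b <= q)%N ->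
  exists l,
    [/\ size l = b, uniq l & {in l, forall y, (y < q)%N && (y \notin s)}].
Proof.
move=> sbq; pose free := [seq y <- iota 0 q | y \notin s].
have size_free : (b <= size free)%N.
  have : (size [seq y <- iota 0 q | y \in s] + size free)%N = q.
    by rewrite !size_filter (count_predC (mem s)) size_iota.
  suff : (size [seq y <- iota 0 q | y \in s] <= size s)%N by lia.
  rewrite uniq_leq_size ?filter_uniq ?iota_uniq // => y.
  by rewrite mem_filter => /andP[].
exists (take b free); split; first exact: size_takel.
  by rewrite take_uniq // filter_uniq ?iota_uniq.
by move=> y /mem_take; rewrite mem_filter mem_iota andbC.
Qed.

(* Besides the values in [extra], the first set takes [y + c] and the second
   takes [y] for [b] values [y < q] outside [avoid]. *)
Lemma exists_shifted_pairs_wsum n' k (extra avoid : seq nat) (b c q : nat) :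
  (q <= c)%N -> (q + c <= n'.+1)%N -> (size avoid + b <= q)%N ->
  uniq extra -> all (ltn^~ n'.+1) extra ->
  (forall y, (y < q)%N ->
    (y \in extra) || (y + c \in extra)%N -> y \in avoid) ->
  exists t : 'S_n'.+1, wsum k (ab_weight (size extra + b) b) t =
    (sumn extra + size extra * k + b * c)%N%:Z.
Proof.
move=> qc qcn avoid_b uniq_extra extra_lt extra_avoid.
have [l [size_l uniq_l l_avoid]] := exists_seq_avoiding avoid_b.
have l_fresh y :
    y \in l -> [/\ (y < q)%N, y \notin extra & (y + c)%N \notin extra].
  move=> /l_avoid/andP[yq]; move/(contra (extra_avoid y yq)).
  by rewrite negb_or => /andP[].
pose la := extra ++ [seq (y + c)%N | y <- l].
have uniq_values : uniq (la ++ l).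
  rewrite cat_uniq uniq_l /la cat_uniq uniq_extra.
  rewrite map_inj_uniq ?uniq_l; last exact: addIn.
  rewrite !andbT /=; apply/andP; split.
    by apply/hasPn => _ /mapP[y /l_fresh[_ _ ycN] ->].
  apply/hasPn => y /l_fresh[yq yN _]; rewrite mem_cat negb_or yN.
  by apply/mapP => -[z _]; lia.
have values_lt : all (ltn^~ n'.+1) (la ++ l).
  rewrite !all_cat extra_lt all_map.
  by apply/andP; split; apply/allP => y /l_fresh[/= yq _ _]; lia.
have [t tE] := exists_perm_wsum k uniq_values values_lt; exists t.
move: tE; rewrite size_cat size_map size_l => ->.
rewrite big_cat big_map -addrA -sumrB PoszD /=; congr (_ + _); last first.
  rewrite (eq_bigr (fun=> c%:Z)) => [|y _]; last by lia.
  by rewrite big_const_seq count_predT iter_addr_0 size_l; lia.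
by elim: (extra) => [|x s IHs]; rewrite ?big_nil // big_cons IHs /=; lia.
Qed.

Lemma exists_shift_dvdn n c :
  (0 < n)%N -> exists2 v, (v < n)%N & (n %| v + c)%N.
Proof.
move=> n_gt0; exists ((n - c %% n) %% n)%N; first by rewrite ltn_mod.
rewrite /dvdn modnDml -modnDmr subnK ?modnn //; exact/ltnW/ltn_pmod.
Qed.

Section ExistenceOfMultiples.

Variables n' k b : nat.
Local Notation n := n'.+1.
Local Notation D1 := (wsum k (@ab_weight n (b + 1) b)).
Local Notation D2 := (wsum k (@ab_weight n (b + 2) b)).
Hypotheses (k_gt0 : (0 < k)%N) (b_gt0 : (0 < b)%N).

Lemma exists_wsum_dvd_diff1 : ((b + 1) + b < n)%N ->
  exists2 t, (n%:Z %| D1 t)%Z & D1 t != 0.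
Proof.
move=> bn; pose q := n./2.
have [v vn nv] := exists_shift_dvdn (k + b * q) (ltn0Sn n').
pose partner := (if v < q then v else v - q)%N.
have [||||||t] := @exists_shifted_pairs_wsum n' k [:: v] [:: partner] b q q.
- by [].
- by rewrite /q; lia.
- by rewrite /q /=; lia.
- by [].
- by rewrite /= vn.
- by move=> y yq; rewrite !inE /partner; case: ifP; lia.
have -> : (sumn [:: v] + 1 * k + b * q = v + (k + b * q))%N by rewrite /=; lia.
by rewrite addnC => tE; exists t; rewrite tE //; lia.
Qed.

Lemma exists_wsum_dvd_unpairable (c q r v : nat) :
  (q <= c)%N -> (q + c <= n)%N -> (b < q)%N -> (r < n)%N ->
  (forall y, (y < q)%N -> y != r /\ (y + c)%N != r) ->
  (v < n)%N -> v != r -> (n %| v + (r + 2 * k + b * c))%N ->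
  exists2 t, (n%:Z %| D2 t)%Z & D2 t != 0.
Proof.
move=> qc qcn bq rn r_fresh vn vr nv.
pose partner := (if v < q then v else v - c)%N.
have [||||||t] := @exists_shifted_pairs_wsum n' k [:: v; r] [:: partner] b c q.
- by [].
- by [].
- by rewrite /=; lia.
- by rewrite /= inE vr.
- by rewrite /= vn rn.
- by move=> y yq; have [] := r_fresh y yq; rewrite !inE /partner; case: ifP; lia.
have -> : (sumn [:: v; r] + 2 * k + b * c = v + (r + 2 * k + b * c))%N.
  by rewrite /=; lia.
by rewrite addnC => tE; exists t; rewrite tE //; lia.
Qed.

(* The pairs [y, y + q] leave out the value [2 q], the pairs [y, y + q + 1] leave
   out [q]; for one of the two the second extra value differs from that one. *)
Lemma exists_wsum_dvd_diff2_odd : ((b + 2) + b < n)%N -> odd n ->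
  exists2 t, (n%:Z %| D2 t)%Z & D2 t != 0.
Proof.
move=> bn n_odd; pose q := n./2; have nE : n = (2 * q + 1)%N by rewrite /q; lia.
have [v vn nv] := exists_shift_dvdn (2 * q + 2 * k + b * q) (ltn0Sn n').
have [vE|v_neq] := eqVneq v (2 * q)%N; last first.
  by apply: (@exists_wsum_dvd_unpairable q q (2 * q) v) => //; lia.
have [u un nu] := exists_shift_dvdn (q + 2 * k + b * q.+1) (ltn0Sn n').
apply: (@exists_wsum_dvd_unpairable q.+1 q q u) => //; try lia.
apply/eqP => uE; move: nv nu; rewrite vE uE => nv nu.
suff : (n %| 2 * q - b)%N by move/dvdn_leq; lia.
have -> : (2 * q - b = (2 * q + (2 * q + 2 * k + b * q))
                     - (q + (q + 2 * k + b * q.+1)))%N by nia.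
exact: dvdn_sub.
Qed.

Lemma exists_wsum_dvd_diff2_even m : ((b + 2) + b < n)%N -> n = (2 * m)%N ->
  exists2 t, (n%:Z %| D2 t)%Z & 2 * n%:Z <= D2 t.
Proof.
move=> bn nE; have m_gt0 : (0 < m)%N by lia.
have multiple z t : D2 t = (z * n)%N%:Z -> (2 <= z)%N ->
    exists2 t, (n%:Z %| D2 t)%Z & 2 * n%:Z <= D2 t.
  move=> tE z_ge2; exists t; rewrite tE; first by rewrite PoszM dvdz_mull.
  by rewrite -PoszM lez_nat leq_mul2r z_ge2 orbT.
have [b_odd|b_even] := boolP (odd b).
  have bE : (b + 1 = 2 * uphalf b)%N by lia.
  have [x xm /dvdnP[z zE]] := exists_shift_dvdn k m_gt0.
  have z_gt0 : (0 < z)%N by nia.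
  have [||||||t] :=
    @exists_shifted_pairs_wsum n' k [:: x; x + m]%N [:: x] b m m.
  - by [].
  - by lia.
  - by rewrite /=; lia.
  - by rewrite /= inE; lia.
  - by rewrite /=; lia.
  - by move=> y ym; rewrite !inE; lia.
  rewrite addnC => tE; apply: (multiple (z + uphalf b)%N t); last by lia.
  by rewrite tE nE /=; nia.
have bE : (b = 2 * b./2)%N by lia.
have [x xm /dvdnP[z zE]] := exists_shift_dvdn k.+1 m_gt0.
have z_gt0 : (0 < z)%N by nia.
pose partner := (if x + 2 < m then x + 2 else x + 2 - m)%N.
have [||||||t] :=
  @exists_shifted_pairs_wsum n' k [:: x; x + 2]%N [:: x; partner] b m m.
- by [].
- by lia.
- by rewrite /=; lia.
- by rewrite /= inE; lia.
- by rewrite /=; lia.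
- by move=> y ym; rewrite !inE /partner; case: ifP; lia.
rewrite addnC => tE; apply: (multiple (z + b./2)%N t); last by lia.
by rewrite tE nE /=; nia.
Qed.

End ExistenceOfMultiples.

Lemma wsum_zero_lt n' k a b :
  (0 < k)%N -> (0 < b)%N ->
  a = (b + 2)%N \/ a = (b + 1)%N -> (a + b < n'.+1)%N ->
  (n'.+1 * #|wsum_zero k (@ab_weight n'.+1 a b)| < #|{: 'S_n'.+1}|)%N.
Proof.
move=> k_gt0 b_gt0 aE abn; have := sum_ab_weight1 (ltnW abn).
case: aE abn => -> abn; last first.
  have [t tn tN0] := exists_wsum_dvd_diff1 k_gt0 b_gt0 abn => sum1.
  apply: (@wsum_zero_lt_coprime _ _ _ (inord 1) t) => //.
  by rewrite sum1 inordK; [rewrite (_ : _ - 1 = 0) ?dvdz0 //; lia | lia].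
rewrite (_ : _ - _ = 2) => [sum2|]; last by lia.
have [n_odd|n_even] := boolP (odd n'.+1).
  have [t tn tN0] := exists_wsum_dvd_diff2_odd k_gt0 b_gt0 abn n_odd.
  apply: (@wsum_zero_lt_coprime _ _ _ (inord n'./2.+1) t) => //.
  by rewrite sum2 inordK; [rewrite (_ : _ - 1 = n'.+1%:Z) ?dvdzz //; lia | lia].
have nE : n'.+1 = (2 * n'.+1./2)%N by lia.
have [t tn t_large] := exists_wsum_dvd_diff2_even k_gt0 b_gt0 abn nE.
exact: (wsum_zero_lt_even (@ab_weight_sign _ _ _) nE sum2 tn t_large).
Qed.

Definition bijection_of_perm n k (t : 'S_n) : {ffun 'I_n -> 'I_(n + k)} :=
  [ffun i => cast_ord (addnC k n) (rshift k ((t^-1)%g i))].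

Lemma bijection_of_permE n k (t : 'S_n) i :
  bijection_of_perm k t i = (k + (t^-1)%g i)%N :> nat.
Proof. by rewrite ffunE. Qed.

Lemma bijection_of_perm_inj n k : injective (@bijection_of_perm n k).
Proof.
move=> t u tu; apply: invg_inj; apply/permP => i; apply: val_inj.
by have := bijection_of_permE k t i; rewrite tu bijection_of_permE => /addnI.
Qed.

Lemma bijectionsE n k : bijections n k = [set bijection_of_perm k t | t : 'S_n].
Proof.
apply/setP => s; rewrite inE.
apply/andP/imsetP => [[/injectiveP s_inj /eqP s_onto]|[t _ ->]].
  have k_le i : (k <= s i)%N.
    by have := imset_f s (in_setT i); rewrite s_onto inE.
  have s_lt i : (s i - k < n)%N by have := ltn_ord (s i); have := k_le i; lia.
  have shift_inj : injective (fun i => Ordinal (s_lt i)).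
    move=> i j /(congr1 val) /= ij; apply: s_inj; apply: val_inj => /=.
    by rewrite -(subnK (k_le i)) ij subnK.
  exists (perm shift_inj)^-1%g; rewrite ?inE //.
  apply/ffunP => i; apply: val_inj.
  by rewrite /= bijection_of_permE invgK permE /= subnKC.
split.
  apply/injectiveP => i j /(congr1 val) /=.
  by rewrite !bijection_of_permE => /addnI /val_inj /perm_inj.
apply/eqP/setP => j; rewrite inE; apply/imsetP/idP => [[i _ ->]|kj].
  by rewrite bijection_of_permE leq_addr.
have jn : (j - k < n)%N by have := ltn_ord j; lia.
exists (t (Ordinal jn)); rewrite ?inE //.
by apply: val_inj; rewrite /= bijection_of_permE permK /= subnKC.
Qed.

Lemma Dstat_bijection_of_perm n' k a b (t : 'S_n'.+1) :
  Dstat a b (bijection_of_perm k t) = wsum k (ab_weight a b) t.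
Proof.
rewrite wsum_inverse sum_ab_weight /Dstat.
by congr (_ - _); apply: eq_bigr => i _; rewrite bijection_of_permE addnC.
Qed.

Lemma unif_pr_Dstat_eq0 n' k a b :
  unif_pr (bijections n'.+1 k) (fun s => Dstat a b s == 0) =
  #|wsum_zero k (@ab_weight n'.+1 a b)|%:R / #|{: 'S_n'.+1}|%:R.
Proof.
have bij_inj := @bijection_of_perm_inj n'.+1 k.
rewrite /unif_pr bijectionsE; congr (_%:R / _%:R); last exact: card_imset.
rewrite -(card_imset (wsum_zero _ _) bij_inj); apply: eq_card => s; rewrite inE.
apply/andP/imsetP => [[/imsetP[t _ ->]]|[t]].
  by rewrite Dstat_bijection_of_perm => t0; exists t; rewrite ?inE.
by rewrite inE -Dstat_bijection_of_perm => t0 ->; rewrite imset_f.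
Qed.

Theorem theorem14 (k n a b : nat) (hk : (0 < k)%N) (hn : (0 < n)%N)
    (ha : (0 < a)%N) (hb : (0 < b)%N)
    (hab : a = (b + 2)%N \/ a = (b + 1)%N) (habn : (a + b < n)%N) :
  unif_pr (bijections n k) (fun s => Dstat a b s == 0) < 1 / n%:R.
Proof.
case: n hn habn => // n' _ habn; rewrite unif_pr_Dstat_eq0.
have zero_lt := wsum_zero_lt hk hb hab habn.
rewrite ltr_pdivrMr ?ltr0n; last exact: leq_trans zero_lt.
by rewrite mulrAC ltr_pdivlMr ?ltr0n // mul1r -natrM ltr_nat mulnC.
Qed.
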